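(* Let $G$ be a simple, undirected, connected graph on $n$ vertices with positive real edge weights, such that $G$ is unicyclic and its unique cycle has exactly 3 edges. Then the distance matrix $D(G)$ is strongly unipositive, i.e. it has exactly 1 positive eigenvalue, no zero eigenvalue, and exactly $n-1$ negative eigenvalues (counted with multiplicity).
   Context: For a connected edge-weighted graph $G$ with vertices $v_1,\dots,v_n$, the distance matrix is the symmetric matrix $D(G)=[d_{ij}]$, where $d_{ij}$ is the minimum, over all paths from $v_i$ to $v_j$ in $G$, of the sum of the edge weights of the path (so $d_{ii}=0$). A graph is unicyclic if it is connected and contains exactly one cycle. A symmetric real $n\times n$ matrix is strongly unipositive if it has exactly one positive eigenvalue and zero is not an eigenvalue (so it has $n-1$ negative eigenvalues). *)

(* Defs.v *)
From mathcomp Require Import all_boot all_order all_algebra.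
From mathcomp Require Import reals.

Set Implicit Arguments.
Unset Strict Implicit.
Unset Printing Implicit Defensive.

Import Order.TTheory GRing.Theory Num.Theory.

Local Open Scope ring_scope.

(* A finite simple graph on [T] is a symmetric irreflexive [e : rel T]; the   *)
(* edge joining [x] and [y] is the unordered pair [[set x; y]], and edge      *)
(* weights are functions on such pairs.                                       *)

Definition cycle_edges (T : finType) (c : seq T) : {set {set T}} :=
  [set [set x; next c x] | x in c].

(* Cycles are identified with their edge sets, so that the rotations and the  *)
(* reversal of a cyclic sequence of vertices denote one and the same cycle.   *)
Definition is_graph_cycle (T : finType) (e : rel T) (C : {set {set T}}) : Prop :=
  exists c : seq T, [/\ ucycle e c, (2 < size c)%N & C = cycle_edges c].

Definition connected_graph (T : finType) (e : rel T) : Prop :=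
  forall x y : T, connect e x y.

Definition unicyclic (T : finType) (e : rel T) : Prop :=
  connected_graph e /\ exists! C : {set {set T}}, is_graph_cycle e C.

(* [x :: p] is a path (without repeated vertices) from [x] to [y].            *)
Definition spath (T : eqType) (e : rel T) (x y : T) (p : seq T) : bool :=
  [&& path e x p, last x p == y & uniq (x :: p)].

Fixpoint path_weight (R : realType) (T : finType) (w : {set T} -> R)
    (x : T) (p : seq T) : R :=
  if p is y :: p' then w [set x; y] + path_weight w y p' else 0.

(* The size bound only serves to range over a finite type: it holds of every  *)
(* repetition-free sequence.                                                  *)
Definition path_weights (R : realType) (T : finType) (e : rel T)
    (w : {set T} -> R) (x y : T) : seq R :=
  [seq path_weight w x (val p) | p <- enum {: #|T|.-bseq T} & spath e x y (val p)].

Definition min_seq (R : realType) (s : seq R) : R :=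
  \big[Num.min/head 0 s]_(a <- s) a.

(* The junk value 0 is only reached when no path joins [x] to [y].            *)
Definition dist (R : realType) (T : finType) (e : rel T) (w : {set T} -> R)
    (x y : T) : R :=
  min_seq (path_weights e w x y).

Definition distmx (R : realType) (n : nat) (e : rel 'I_n)
    (w : {set 'I_n} -> R) : 'M[R]_n :=
  \matrix_(i, j) dist e w i j.

(* [s] lists the eigenvalues of [A], each repeated according to its algebraic *)
(* multiplicity; [s] is unique up to permutation.                             *)
Definition is_spectrum (R : realType) (n : nat) (A : 'M[R]_n) (s : seq R) : Prop :=
  char_poly A = \prod_(a <- s) ('X - a%:P).

Definition strongly_unipositive (R : realType) (n : nat) (A : 'M[R]_n) : Prop :=
  A^T = A /\
  exists s : seq R,
    [/\ is_spectrum A s,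
        count (fun a : R => 0 < a) s = 1%N,
        0 \notin s
      & count (fun a : R => a < 0) s = n.-1].

(* Main.v *)
(* Write q for the quadratic form of the distance matrix D. The point is that
   q is negative on nonzero vectors with coordinate sum 0. On the three vertices
   of the triangle this follows from the triangle inequality. The other vertices
   are attached one at a time: a new vertex v adjacent to u in the current set S
   satisfies d(v, x) = w(uv) + d(u, x) on S, since a path reaching S elsewhere
   would close up to a second cycle; moving the mass m of v to u then changes q
   by exactly 2 w(uv) m^2. Hence D has at most one nonnegative eigenvalue, for
   otherwise two eigenvectors would span a plane meeting that hyperplane; as the
   trace of D is 0, this eigenvalue is positive. *)

Require Import Defs.
From mathcomp Require Import all_boot all_order all_algebra.
From mathcomp Require Import reals.
From mathcomp Require Import ring lra complex.

Set Implicit Arguments.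
Unset Strict Implicit.
Unset Printing Implicit Defensive.

Import Order.TTheory GRing.Theory Num.Theory.

Local Open Scope ring_scope.

(** * Minima of lists and the metric of a weighted connected graph *)

Lemma min_seq_le (R : realType) (s : seq R) (a : R) : a \in s -> min_seq s <= a.
Proof.
rewrite /min_seq; move: (head 0 s) => z; elim: s => [//|b s IHs].
rewrite inE big_cons ge_min => /predU1P[->|/IHs ->];
  by rewrite ?lexx ?orbT.
Qed.

(** The seed of the fold is the head of the list, hence an entry, and the minimum of two entries is
    one of them. *)
Lemma min_seq_mem (R : realType) (s : seq R) : s != [::] -> min_seq s \in s.
Proof.
case: s => // a s _; rewrite /min_seq big_seq.
apply: (big_ind (fun x => x \in a :: s)) => [|x y xs ys|//].
  exact: mem_head.
by rewrite minEle; case: ifP.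
Qed.

Lemma uniq_size_card (T : finType) (s : seq T) : uniq s -> (size s <= #|T|)%N.
Proof. by move/card_uniqP <-; apply: max_card. Qed.

Section GraphDist.
Variables (R : realType) (T : finType) (e : rel T) (w : {set T} -> R).
Hypothesis (e_sym : symmetric e) (e_conn : connected_graph e).
Hypothesis w_gt0 : forall x y, e x y -> 0 < w [set x; y].

Lemma path_weight_cat x p q :
  path_weight w x (p ++ q) = path_weight w x p + path_weight w (last x p) q.
Proof. by elim: p x => [|y p IHp] x /=; rewrite ?add0r // IHp addrA. Qed.

Lemma path_weight_ge0 x p : path e x p -> 0 <= path_weight w x p.
Proof.
elim: p x => [//|y p IHp] x /= /andP[exy /IHp].
exact/addr_ge0/ltW/w_gt0.
Qed.

Lemma dist_le x y p : spath e x y p -> dist e w x y <= path_weight w x p.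
Proof.
move=> xyp; have /and3P[_ _ Up] := xyp.
have sz_p : (size p <= #|T|)%N by exact: ltnW (uniq_size_card Up).
apply: min_seq_le; apply/mapP; exists (Bseq sz_p) => //.
by rewrite mem_filter mem_enum andbT.
Qed.

Lemma dist_attained x y :
  exists2 p, spath e x y p & dist e w x y = path_weight w x p.
Proof.
(* Connectedness excludes the junk value: some path exists, and it can be shortened to a
   repetition-free one. *)
have : path_weights e w x y != [::].
  have /connectP[p0 ep0 ->] := e_conn x y.
  case/shortenP: ep0 => p ep Up _.
  have sz_p : (size p <= #|T|)%N by exact: ltnW (uniq_size_card Up).
  apply: contraTneq isT => D0; have : path_weight w x p \in path_weights e w x (last x p).
    apply/mapP; exists (Bseq sz_p) => //.
    by rewrite mem_filter mem_enum andbT /spath ep eqxx.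
  by rewrite D0.
move/min_seq_mem/mapP => [p]; rewrite mem_filter => /andP[xyp _] Dd.
by exists (val p).
Qed.

Lemma distxx x : dist e w x x = 0.
Proof.
have [p xxp ->] := dist_attained x x.
have /and3P[_] := xxp; case: p {xxp} => //= y p /eqP <- /andP[].
by rewrite mem_last.
Qed.

Lemma dist_gt0 x y : x != y -> 0 < dist e w x y.
Proof.
have [p /and3P[ep /eqP <- _] -> {y}] := dist_attained x y.
case: p ep => [|y p] /=; first by rewrite eqxx.
case/andP=> /w_gt0 wxy /path_weight_ge0 ? _; exact: ltr_wpDr.
Qed.

(** Take a shortest path from [y] to [z]. If it avoids [x], prepend the edge; if it meets [x], its
    tail from [x] is already a path to [z] of no larger weight. *)
Lemma dist_step x y z : e x y -> dist e w x z <= w [set x; y] + dist e w y z.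
Proof.
move=> exy; have [p /and3P[ep /eqP <- Up] -> {z}] := dist_attained y z.
have [x_p|x_p] := boolP (x \in y :: p); last first.
  by apply: (@dist_le _ _ (y :: p)); rewrite /spath /= exy ep eqxx x_p.
case/splitPl: p / x_p ep Up => p1 p2 Dx; rewrite cat_path last_cat.
rewrite path_weight_cat -cat_cons cat_uniq Dx.
case/andP=> ep1 ep2 /and3P[_ xp2 Up2].
have: dist e w x (last x p2) <= path_weight w x p2.
  apply: dist_le; rewrite /spath ep2 eqxx /= Up2 andbT.
  by apply: contra xp2 => xp2; apply/hasP; exists x; rewrite // -Dx mem_last.
move/le_trans; apply; rewrite addrA lerDr addr_ge0 ?path_weight_ge0 //.
exact/ltW/w_gt0.
Qed.

(** Applying [dist_step] along the edges of a shortest path from [x] to [y] avoids removing loops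
    from a concatenation of two paths. *)
Lemma dist_triangle x y z : dist e w x z <= dist e w x y + dist e w y z.
Proof.
have [p /and3P[ep /eqP <- _] -> {y}] := dist_attained x y.
elim: p x ep => [|y p IHp] x /=; first by rewrite add0r.
case/andP=> /(dist_step z) le_xz /IHp IH.
by rewrite -addrA (le_trans le_xz) // lerD2l.
Qed.

Lemma dist_edge x y : e x y -> dist e w x y <= w [set x; y].
Proof. by move=> /(dist_step y); rewrite distxx addr0. Qed.

(** One inequality for all pairs suffices. It follows edge by edge from the triangle inequality, as
    an edge weighs the same in both directions; no path is reversed. *)
Lemma dist_sym x y : dist e w x y = dist e w y x.
Proof.
suff le_d a b : dist e w b a <= dist e w a b by apply/eqP; rewrite eq_le !le_d.
have [p /and3P[ep /eqP <- _] -> {b}] := dist_attained a b.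
elim: p a ep => [|c p IHp] a /=; first by rewrite distxx.
case/andP=> eac /IHp IH; apply: le_trans (dist_triangle _ c _) _.
by rewrite addrC lerD // setUC dist_edge // e_sym.
Qed.

(** * Induced subgraphs and attaching a vertex *)

Definition induced (S : {set T}) : rel T :=
  [rel x y | [&& x \in S, y \in S & e x y]].

Definition connected_in (S : {set T}) : Prop :=
  {in S &, forall x y, connect (induced S) x y}.

Lemma connected_inU1 (S : {set T}) u v :
  connected_in S -> u \in S -> e u v -> connected_in (v |: S).
Proof.
move=> conS uS euv.
have symU : connect_sym (induced (v |: S)).
  by apply: sym_connect_sym => x y; rewrite /induced /= e_sym andbCA.
have sub x y : connect (induced S) x y -> connect (induced (v |: S)) x y.
  by apply: connect_sub => a b /and3P[aS bS eab]; rewrite connect1 // /induced /= !inE aS bS !orbT.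
have from_u x : x \in v |: S -> connect (induced (v |: S)) u x.
  case/setU1P=> [->|xS]; last exact/sub/conS.
  by rewrite connect1 // /induced /= !inE uS eqxx orbT.
move=> x y xS yS; rewrite (connect_trans _ (from_u y yS)) // symU.
exact: from_u.
Qed.

Lemma induced_pathP (S : {set T}) x p :
  path (induced S) x p -> {subset p <= S} /\ path e x p.
Proof.
elim: p x => [//|y p IHp] x /= /andP[/and3P[_ yS ->] /IHp[pS ->]].
by split=> // z /predU1P[->|/pS].
Qed.

(* Every path from [v] to [S] starts with the edge [v u]: otherwise its initial
   part up to [S] closes up, inside [S] and by [u v], to a cycle through [v]. *)
Lemma dist_attach (S : {set T}) u v x :
    (forall c, ucycle e c -> (2 < size c)%N -> {subset c <= S}) ->
    connected_in S -> u \in S -> v \notin S -> e u v -> x \in S ->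
  dist e w v x = w [set u; v] + dist e w u x.
Proof.
move=> cycS conS uS vS euv xS; apply/eqP; rewrite eq_le {1}setUC dist_step 1?e_sym //=.
have [p vxp ->] := dist_attained v x.
have /and3P[ep lp Up] := vxp.
have hp : has (mem S) p.
  apply/hasP; exists x => //; rewrite -(eqP lp); case: p lp {ep Up vxp} => [/= /eqP Dx|y p _ /=].
    by rewrite Dx xS in vS.
  exact: mem_last.
case: (split_find hp) ep lp Up => u' p1 p2 u'S p1S.
rewrite cat_path last_cat last_rcons -cat_cons cat_uniq rcons_path.
case/andP=> /andP[ep1 eu'] ep2 lp2 /and3P[Up1 p1p2 Up2].
have /connectP[q0 eq0 Dq] := conS u' u u'S uS.
case/shortenP: eq0 Dq => q eq Uq _ Du {q0}.
have [qS eq'] := induced_pathP eq.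
(* Go from [v] along [p1] to [u'], the first vertex of the path in [S], then along [q] inside [S] to
   [u], and back to [v]. This is a cycle through [v] unless [p1] and [q] are both empty, and then
   [u'] is [u]. *)
have [sz_c|sz_c] := ltnP 2 (size (v :: p1 ++ u' :: q)).
  have : v \in S; last by rewrite (negPf vS).
  apply: (cycS _ _ sz_c _ (mem_head _ _)); rewrite /ucycle /cycle.
  apply/andP; split.
    by rewrite rcons_path cat_path last_cat /= ep1 eu' eq' -Du.
  have Uvp1 : uniq (v :: p1) by move: Up1; rewrite -rcons_cons rcons_uniq => /andP[].
  rewrite -cat_cons cat_uniq Uvp1 Uq andbT.
  apply/hasPn => y y_q; rewrite inE negb_or.
  have yS : y \in S by case/predU1P: y_q => [->|/qS].
  apply/andP; split; first by apply: contraNneq vS => <-.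
  by apply: contra p1S => y_p1; apply/hasP; exists y.
have [-> q_nil] : p1 = [::] /\ q = [::].
  by case: (p1) (q) sz_c => [|? []] // [].
have u'p2 : u' \notin p2.
  by apply: contra p1p2 => u'_p2; apply/hasP; exists u'; rewrite // !inE mem_rcons mem_head orbT.
rewrite /= {}Du q_nil setUC lerD2l.
by apply: dist_le; rewrite /spath ep2 lp2 /= u'p2.
Qed.
End GraphDist.

(** * Quadratic forms and spectra of real symmetric matrices *)

Definition qform (R : pzRingType) (n : nat) (A : 'M[R]_n) (v : 'rV[R]_n) : R :=
  (v *m A *m v^T) 0 0.

Definition coordsum (R : pzRingType) (n : nat) (v : 'rV[R]_n) : R := \sum_j v 0 j.

Lemma char_poly_similar (R : comUnitRingType) (n : nat) (U B : 'M[R]_n) :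
  U \in unitmx -> char_poly (invmx U *m B *m U) = char_poly B.
Proof.
move=> Uu; rewrite /char_poly /char_poly_mx !map_mxM /=.
set V := map_mx _ U; set W := map_mx _ (invmx U).
have WV : W *m V = 1%:M by rewrite -map_mxM mulVmx // map_mx1.
have -> : 'X%:M - W *m map_mx polyC B *m V = W *m ('X%:M - map_mx polyC B) *m V.
  by rewrite mulmxBr mulmxBl (scalar_mxC 'X W) -(mulmxA _ W V) WV mulmx1.
by rewrite !det_mulmx mulrAC -det_mulmx WV det1 mul1r.
Qed.

Section Spectrum.
Local Open Scope complex_scope.
Local Open Scope sesquilinear_scope.

Variables (R : realType) (n : nat) (A : 'M[R]_n).
Hypothesis A_sym : A^T = A.

Let C := complex R.
Let toC : {rmorphism R -> C} := real_complex R.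
Let AC : 'M[C]_n := map_mx toC A.
(** The rows of this unitary matrix are eigenvectors of [A], possibly with nonreal entries. *)
Let U : 'M[C]_n := spectralmx AC.
Let d : 'rV[C]_n := spectral_diag AC.

(** Over the complex numbers [A] is Hermitian, so its spectral diagonal is real and taking real
    parts loses nothing. *)
Lemma spectrum_exists : exists ev : 'I_n -> R,
  AC = invmx U *m diag_mx (\row_j toC (ev j)) *m U.
Proof.
have AChs : AC \is hermsymmx.
  apply: realsym_hermsym.
    by apply/is_hermitianmxP; rewrite expr0 scale1r map_mx_id // map_trmx A_sym.
  by apply/mxOverP => i j; rewrite mxE; apply/complex_realP; exists (A i j).
have d_real := hermitian_spectral_diag_real AChs.
exists (fun j => complex.Re (d 0 j)).
have /hermitian_normalmx/orthomx_spectralP -> := AChs.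
congr (_ *m diag_mx _ *m _); apply/rowP => j; rewrite mxE /toC /= RRe_real //.
by move/mxOverP: d_real; apply.
Qed.

Lemma spectrumP (ev : 'I_n -> R) : AC = invmx U *m diag_mx (\row_j toC (ev j)) *m U ->
  is_spectrum A (codom ev).
Proof.
move=> ACE; rewrite /is_spectrum; apply: (map_poly_inj toC).
rewrite map_char_poly -/AC ACE.
have Uu : U \in unitmx by exact: spectral_unit.
rewrite char_poly_similar // char_poly_trig ?diag_mx_is_trig //.
rewrite rmorph_prod big_map big_enum /=; apply: eq_bigr => j _.
by rewrite map_polyXsubC !mxE eqxx mulr1n.
Qed.

(** The cross terms cancel by symmetry of [A]. This carries bounds on real vectors over to complex
    combinations of eigenvectors. *)
Lemma qform_ReIm (z : 'rV[C]_n) :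
  toC (qform A (map_mx (@complex.Re R) z) + qform A (map_mx (@complex.Im R) z))
   = (z *m AC *m z^t*) 0 0.
Proof.
have zE : z = map_mx toC (map_mx (@complex.Re R) z)
    + 'i%C *: map_mx toC (map_mx (@complex.Im R) z).
  by apply/rowP => j; rewrite !mxE -complexE.
have ztE : z^t* = map_mx toC (map_mx (@complex.Re R) z)^T
    - 'i%C *: map_mx toC (map_mx (@complex.Im R) z)^T.
  by apply/colP => j; rewrite !mxE; case: (z 0 j) => a b; simpc.
rewrite ztE {3}zE; set x := map_mx (@complex.Re R) z; set y := map_mx (@complex.Im R) z.
have cross : y *m A *m x^T = x *m A *m y^T.
  transitivity (y *m A *m x^T)^T; last by rewrite !trmx_mul trmxK A_sym mulmxA.
  by apply/matrixP => i j; rewrite [RHS]mxE !ord1.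
rewrite mulmxBr !mulmxDl -!scalemxAr -!scalemxAl scalerA -!map_mxM cross.
rewrite -expr2 sqr_i scaleN1r /qform rmorphD !mxE /=.
by rewrite opprB addrACA subrr addr0.
Qed.

Lemma qform_spectral (ev : 'I_n -> R) (r : 'rV[C]_n) :
  AC = invmx U *m diag_mx (\row_j toC (ev j)) *m U ->
  (r *m U *m AC *m (r *m U)^t*) 0 0 = \sum_j `|r 0 j| ^+ 2 * toC (ev j).
Proof.
move=> ACE.
have UU : U *m U^t* = 1%:M by apply/unitarymxP/spectral_unitarymx.
have iU : invmx U = U^t* by apply/invmx_unitary/spectral_unitarymx.
rewrite ACE iU !mulmxA trmx_mul map_mxM !mulmxA.
rewrite -[r *m U *m _]mulmxA UU mulmx1 -[_ *m U *m _]mulmxA UU mulmx1 mxE.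
by apply: eq_bigr => j _; rewrite mul_mx_diag !mxE normCK mulrAC.
Qed.

(** For [i != j], some nonzero combination [z] of the two eigenvectors has coordinate sum 0. Its
    Hermitian form is nonnegative by the spectral expansion, yet negative by the hypothesis applied
    to the real and imaginary parts of [z]. *)
Lemma nonneg_eigenvalue_inj (ev : 'I_n -> R) (i j : 'I_n) :
  AC = invmx U *m diag_mx (\row_j toC (ev j)) *m U ->
  (forall v, coordsum v = 0 -> v != 0 -> qform A v < 0) ->
  0 <= ev i -> 0 <= ev j -> i = j.
Proof.
move=> ACE negA ei ej; apply/eqP; apply: contraT => ij.
pose s k := coordsum (row k U).
have [a [b [ab0 abs]]] : exists a b : C, (a != 0) || (b != 0) /\ a * s i + b * s j = 0.
  have [sj0|sj0] := eqVneq (s j) 0.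
    by exists 0, 1; rewrite oner_eq0 orbT mul0r mul1r sj0 addr0.
  by exists (s j), (- s i); rewrite sj0 mulNr mulrC subrr.
(* [r] holds the coordinates of [z] in the eigenvector basis. *)
pose r : 'rV[C]_n := a *: delta_mx 0 i + b *: delta_mx 0 j.
have rk k : r 0 k = a * (k == i)%:R + b * (k == j)%:R by rewrite !mxE !eqxx.
have r0 : r != 0.
  apply/eqP => /rowP r0; move: (r0 i) (r0 j) ab0; rewrite !rk !mxE !eqxx.
  rewrite (negPf ij) eq_sym (negPf ij) !mulr1 !mulr0 addr0 add0r.
  by move=> -> ->; rewrite eqxx.
pose z := r *m U.
have z0 : z != 0.
  apply: contraNneq r0 => z0; rewrite -(mulmxK (spectral_unit AC) r).
  by rewrite -/U -/z z0 mul0mx.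
have sumz : coordsum z = 0.
  rewrite -abs /s /coordsum !mulr_sumr -big_split /=; apply: eq_bigr => k _.
  by rewrite /z mulmxDl -!scalemxAl -!rowE !mxE.
pose x := map_mx (@complex.Re R) z; pose y := map_mx (@complex.Im R) z.
have sumxy : coordsum x = 0 /\ coordsum y = 0.
  have zE : coordsum z = toC (coordsum x) + 'i%C * toC (coordsum y).
    rewrite /coordsum !rmorph_sum mulr_sumr -big_split /=; apply: eq_bigr => k _.
    by rewrite !mxE -complexE.
  by move: sumz; rewrite zE /=; simpc => /eqP; rewrite eq_complex /= => /andP[/eqP-> /eqP->].
have xy0 : (x != 0) || (y != 0).
  rewrite -negb_and; apply: contra z0 => /andP[/eqP/rowP x0 /eqP/rowP y0].
  apply/eqP/rowP => k; move: (x0 k) (y0 k); rewrite [X in _ -> _ -> X = _]complexE !mxE => -> ->.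
  by simpc.
have qle v : coordsum v = 0 -> qform A v <= 0.
  have [-> _|v0 sv] := eqVneq v 0; last exact/ltW/negA.
  by rewrite /qform !mul0mx mxE.
have qlt : qform A x + qform A y < 0.
  case: sumxy => sx sy; case/orP: xy0 => ?.
    by apply: ltr_wnDr; rewrite ?qle ?negA.
  by apply: ltr_wnDl; rewrite ?qle ?negA.
suff : 0 <= toC (qform A x + qform A y) by rewrite ler0c leNgt qlt.
rewrite qform_ReIm (qform_spectral _ ACE); apply: sumr_ge0 => k _.
rewrite rk; have [->|_] := eqVneq k i; first by rewrite mulr_ge0 ?exprn_ge0 // ler0c.
have [->|_] := eqVneq k j; first by rewrite mulr_ge0 ?exprn_ge0 // ler0c.
by rewrite !mulr0 addr0 normr0 expr0n mul0r.
Qed.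

End Spectrum.

Lemma strongly_unipositive_of_negative_type (R : realType) (n : nat) (A : 'M[R]_n) :
  (1 < n)%N -> A^T = A -> \tr A = 0 ->
  (forall v, coordsum v = 0 -> v != 0 -> qform A v < 0) ->
  strongly_unipositive A.
Proof.
move=> n1 A_sym trA negA; split=> //.
have [ev ACE] := spectrum_exists A_sym.
have ev_inj i j := nonneg_eigenvalue_inj A_sym ACE negA (i := i) (j := j).
have ev_sum : \sum_i ev i = 0.
  apply: (@complexI R); transitivity (real_complex R (\tr A)); last by rewrite trA.
  rewrite -trace_map_mx ACE.
  rewrite -mulmxA mxtrace_mulC -mulmxA mulmxV ?spectral_unit // mulmx1 mxtrace_diag.
  by rewrite (rmorph_sum (real_complex R)); apply: eq_bigr => j _; rewrite mxE.
(* Without a positive eigenvalue, all would vanish because they sum to the trace 0. Indices 0 and 1,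
   distinct as [1 < n], would then contradict [ev_inj]. *)
have [i0 i0_gt0] : exists i, 0 < ev i.
  apply/existsP; apply: contraT; rewrite negb_exists => /forallP ev_le0.
  have ev0 i : ev i = 0.
    have : \sum_i - ev i == 0 by rewrite sumrN ev_sum oppr0.
    rewrite psumr_eq0 => [/allP/(_ i)|k _]; last by rewrite oppr_ge0 leNgt.
    by rewrite mem_index_enum oppr_eq0 => /(_ isT)/eqP.
  have := ev_inj (Ordinal (ltnW n1)) (Ordinal n1).
  by rewrite !ev0 lexx => /(_ isT isT) [].
have ev_lt0 i : i != i0 -> ev i < 0.
  by apply: contraNT; rewrite -leNgt => ei; apply/eqP/ev_inj => //; apply: ltW.
have neg_gt i : (ev i < 0) = (i != i0).
  by have [->|/ev_lt0 //] := eqVneq i i0; rewrite ltNge ltW.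
have pos_eq i : (0 < ev i) = (i == i0).
  by have [->//|/ev_lt0 e0] := eqVneq i i0; rewrite ltNge ltW.
exists (codom ev); split.
- exact: spectrumP.
- rewrite codomE count_map (eq_count (a2 := pred1 i0)) => [|i]; last exact: pos_eq.
  by rewrite count_uniq_mem ?enum_uniq // mem_enum.
- apply/codomP => -[i e0]; have [ii0|/ev_lt0] := eqVneq i i0.
    by move: i0_gt0; rewrite -ii0 -e0 ltxx.
  by rewrite -e0 ltxx.
- rewrite codomE count_map (eq_count (a2 := predC (pred1 i0))) => [|i]; last exact: neg_gt.
  rewrite -[n in RHS](size_enum_ord n) -(count_predC (pred1 i0)).
  by rewrite count_uniq_mem ?enum_uniq // mem_enum.
Qed.

(** * Strict negative type *)

(** Vectors supported on [S] stand for the principal submatrix indexed by [S], so the index type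
    stays fixed while [S] grows. *)
Definition negative_type_on (R : realType) (n : nat) (A : 'M[R]_n) (S : {set 'I_n}) :=
  forall v : 'rV[R]_n, (forall i, i \notin S -> v 0 i = 0) ->
  coordsum v = 0 -> v != 0 -> qform A v < 0.

(** Let [h] be the unit mass at [j] minus that at [i]. On [S] the row [h *m A] is constantly [l], so
    it pairs to 0 with any vector supported on [S] of sum 0. The cross terms thus vanish, and [h]
    itself contributes [- 2 * l]. *)
Lemma negative_type_pendant (R : realType) (n : nat) (A : 'M[R]_n)
    (S : {set 'I_n}) (i j : 'I_n) (l : R) :
  A^T = A -> (forall k, A k k = 0) -> i \in S -> j \notin S -> 0 < l ->
  (forall k, k \in S -> A j k = l + A i k) ->
  negative_type_on A S -> negative_type_on A (j |: S).
Proof.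
move=> A_sym A0 iS jS l0 Aj negS v vS v_sum v_neq0.
have ij : i != j by apply: contraNneq jS => <-.
pose m := v 0 j; pose h : 'rV[R]_n := delta_mx 0 j - delta_mx 0 i.
have [u vE] : exists u, v = u + m *: h by exists (v - m *: h); rewrite subrK.
have uE k : u 0 k = v 0 k - m * ((k == j)%:R - (k == i)%:R).
  by rewrite vE !mxE !eqxx /= addrK.
have uS k : k \notin S -> u 0 k = 0.
  move=> kS; rewrite uE; have [->|kj] := eqVneq k j.
    by rewrite (eq_sym j) (negPf ij) subr0 mulr1 subrr.
  rewrite vS ?inE ?negb_or ?kj //; have [ki|_] := eqVneq k i; first by rewrite ki iS in kS.
  by rewrite subrr mulr0 subr0.
have sum_delta k : \sum_(x < n) (x == k)%:R = 1 :> R.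
  by rewrite (bigD1 k) //= eqxx big1 ?addr0 // => x /negPf->.
have u_sum : coordsum u = 0.
  rewrite /coordsum (eq_bigr _ (fun k _ => uE k)) sumrB -mulr_sumr sumrB !sum_delta.
  by rewrite subrr mulr0 subr0.
have hA k : (h *m A) 0 k = A j k - A i k.
  by rewrite /h mulmxBl -!rowE !mxE.
have huE : (h *m A *m u^T) 0 0 = 0.
  transitivity (\sum_k l * u 0 k); last by rewrite -mulr_sumr -/(coordsum u) u_sum mulr0.
  rewrite mxE; apply: eq_bigr => k _; rewrite [u^T _ _]mxE hA.
  by have [kS|/uS->] := boolP (k \in S); [rewrite Aj // addrK | rewrite !mulr0].
have uhE : (u *m A *m h^T) 0 0 = 0.
  rewrite -huE; transitivity ((h *m A *m u^T)^T 0 0); last by rewrite mxE.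
  by rewrite !trmx_mul trmxK A_sym mulmxA.
have hhE : (h *m A *m h^T) 0 0 = - 2 * l.
  have -> : h^T = delta_mx j 0 - delta_mx i 0 by rewrite linearB /= !trmx_delta.
  have Aij : A i j = l by rewrite -[A]A_sym mxE Aj // A0 addr0.
  have Aji : A j i = l by rewrite Aj // A0 addr0.
  have colB (x : 'rV[R]_n) : (x *m (delta_mx j 0 - delta_mx i 0 : 'cV_n)) 0 0 = x 0 j - x 0 i.
    by rewrite mulmxBr -!colE !mxE.
  by rewrite colB !hA !A0 Aij Aji; ring.
have qE : qform A v = qform A u - 2 * l * m ^+ 2.
  have -> : qform A v = ((u + m *: h) *m A *m (u^T + m *: h^T)) 0 0.
    by rewrite -[in u^T + _]linearZ -[in X in _ *m X]linearD -vE.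
  have addE (X Y : 'M[R]_1) : (X + Y) 0 0 = X 0 0 + Y 0 0 by rewrite mxE.
  have scaleE x (X : 'M[R]_1) : (x *: X) 0 0 = x * X 0 0 by rewrite mxE.
  rewrite /qform !mulmxDl !mulmxDr -!scalemxAl -!scalemxAr !addE !scaleE huE uhE hhE; ring.
(* If [u] is 0, then [v] is a nonzero multiple of [h] and strictness comes from the term in [m]. *)
rewrite qE; have [u0|u_neq0] := eqVneq u 0; last first.
  have := negS u uS u_sum u_neq0.
  suff: 0 <= 2 * l * m ^+ 2 by lra.
  by rewrite mulr_ge0 ?sqr_ge0 // mulr_ge0 // ltW.
have m_neq0 : m != 0.
  by apply: contra v_neq0 => /eqP m0; rewrite vE u0 m0 scale0r addr0.
by rewrite u0 /qform !mul0mx mxE sub0r oppr_lt0 mulr_gt0 ?exprn_even_gt0 ?mulr_gt0.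
Qed.

(** After eliminating the mass at [c], the form is -2 times the sum, over the legs of a tripod, of
    the leg length times the squared mass at its end. Legs are nonnegative by the triangle
    inequalities, two legs add up to a side, and at least two masses are nonzero. *)
Lemma negative_type_triangle (R : realType) (n : nat) (A : 'M[R]_n) (a b c : 'I_n) :
  A^T = A -> (forall k, A k k = 0) -> uniq [:: a; b; c] ->
  0 < A a b -> 0 < A b c -> 0 < A c a ->
  A a b <= A b c + A c a -> A b c <= A c a + A a b -> A c a <= A a b + A b c ->
  negative_type_on A [set x in [:: a; b; c]].
Proof.
move=> A_sym A0 Uabc ab bc ca tab tbc tca v vS v_sum v0.
have sum3 (F : 'I_n -> R) : (forall i, i \notin [:: a; b; c] -> F i = 0) ->
    \sum_i F i = F a + F b + F c.
  move=> F0; rewrite (bigID (mem [:: a; b; c])) /= addrC big1 ?add0r //.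
  by rewrite -big_uniq // !big_cons big_nil /= addr0 addrA.
have v0' i : i \notin [:: a; b; c] -> v 0 i = 0 by move=> iS; apply: vS; rewrite inE.
have As i j : A i j = A j i by rewrite -[in LHS]A_sym mxE.
have vabc : v 0 a + v 0 b + v 0 c = 0 by rewrite -sum3.
have qE : qform A v = 2 * (v 0 a * v 0 b * A a b + v 0 b * v 0 c * A b c + v 0 c * v 0 a * A c a).
  rewrite /qform mxE sum3 => [|i /v0' vi]; last by rewrite [v^T _ _]mxE vi mulr0.
  rewrite !mxE !sum3; try by move=> i /v0' ->; rewrite mul0r.
  rewrite !A0 (As b a) (As c b) (As a c); ring.
have v_ab : (v 0 a != 0) || (v 0 b != 0).
  rewrite -negb_and; apply: contra v0 => /andP[/eqP va /eqP vb].
  apply/eqP/rowP => i; rewrite mxE; have [|/v0' //] := boolP (i \in [:: a; b; c]).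
  rewrite !inE => /or3P[]/eqP-> //.
  by move: vabc; rewrite va vb !add0r.
rewrite qE; have -> : v 0 c = - v 0 a - v 0 b by lra.
move: (v 0 a) (v 0 b) v_ab => x y xy.
(* The legs of the tripod isometric to the triangle: at most one vanishes. *)
pose al := (A b c + A c a - A a b) / 2; pose be := (A a b + A b c - A c a) / 2.
pose ga := (A a b + A c a - A b c) / 2.
suff: 0 < al * (x + y) ^+ 2 + be * y ^+ 2 + ga * x ^+ 2.
  move=> pos; have -> : 2 * (x * y * A a b + y * (- x - y) * A b c + (- x - y) * x * A c a)
      = - 2 * (al * (x + y) ^+ 2 + be * y ^+ 2 + ga * x ^+ 2).
    by rewrite /al /be /ga; field.
  by rewrite mulNr oppr_lt0 mulr_gt0.
have al0 : 0 <= al by rewrite /al; lra.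
have be0 : 0 <= be by rewrite /be; lra.
have ga0 : 0 <= ga by rewrite /ga; lra.
have sq_gt0 z : z != 0 -> 0 < z ^+ 2 :> R by move=> z0; rewrite exprn_even_gt0.
(* When one of the two masses vanishes, the other two of the three squares agree, and their
   coefficients add up to a side. *)
have [x0|x0] := eqVneq x 0.
  rewrite x0 eqxx /= in xy *; have := sq_gt0 _ xy; have : 0 < al + be by rewrite /al /be; lra.
  nra.
have [y0|y0] := eqVneq y 0.
  rewrite y0; have := sq_gt0 _ x0; have : 0 < al + ga by rewrite /al /ga; lra.
  nra.
(* Here both masses are nonzero, so one positive leg among [be] and [ga] is enough. *)
have bg : 0 < be + ga by rewrite /be /ga; lra.
have := sq_gt0 _ x0; have := sq_gt0 _ y0; have := sqr_ge0 (x + y).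
move: (x ^+ 2) (y ^+ 2) ((x + y) ^+ 2) => X Y Z Z0 Y0 X0.
have /orP[gt0|gt0] : (0 < be) || (0 < ga).
- by case: (ltP 0 be) => //= ?; lra.
- have := mulr_gt0 gt0 Y0; have := mulr_ge0 al0 Z0; have := mulr_ge0 ga0 (ltW X0); lra.
- have := mulr_gt0 gt0 X0; have := mulr_ge0 al0 Z0; have := mulr_ge0 be0 (ltW Y0); lra.
Qed.

(** * Edge sets of cycles *)

Lemma next_sym_size (T : eqType) (c : seq T) (x : T) :
  uniq c -> x \in c -> next c (next c x) = x -> (size c <= 2)%N.
Proof.
move=> Uc /rot_to[i c' Dc]; rewrite -(size_rot i) -!(next_rot i Uc).
move: Uc; rewrite -(rot_uniq i) Dc; case: c' {Dc} => [|y [|z s]] //=.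
rewrite eqxx !inE !negb_or => /and3P[/and3P[xy xz _] _ _].
rewrite eq_sym (negPf xy) eqxx => Dz; by rewrite Dz eqxx in xz.
Qed.

(** If distinct [x] and [y] gave the same edge, each would be the successor of the other, which
    forces length at most 2. *)
Lemma card_cycle_edges (T : finType) (c : seq T) :
  uniq c -> (2 < size c)%N -> #|cycle_edges c| = size c.
Proof.
move=> Uc sz_c; rewrite card_in_imset ?(card_uniqP Uc) // => x y xc yc.
move=> Exy; have : x \in [set y; next c y] by rewrite -Exy set21.
have : y \in [set x; next c x] by rewrite Exy set21.
rewrite !inE => /orP[/eqP //|/eqP yx] /orP[/eqP //|/eqP xy].
by move: sz_c; rewrite ltnNge (next_sym_size Uc xc) // -yx -xy.
Qed.

(** This turns uniqueness of the cycle as an edge set into a statement on vertices. *)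
Lemma cycle_edges_mem (T : finType) (c c' : seq T) :
  cycle_edges c = cycle_edges c' -> {subset c <= c'}.
Proof.
move=> Ec x xc; have : [set x; next c x] \in cycle_edges c' by rewrite -Ec; apply: imset_f.
case/imsetP => y yc' Exy; have : x \in [set y; next c' y] by rewrite -Exy set21.
by rewrite !inE => /orP[]/eqP-> //; rewrite mem_next.
Qed.

(** * Growing the triangle to the whole graph *)

Lemma connected_exit (T : finType) (e : rel T) (S : {set T}) (x : T) :
  connected_graph e -> x \in S -> S != setT ->
  exists u v, [/\ u \in S, v \notin S & e u v].
Proof.
move=> e_conn xS; rewrite -subTset => /subsetPn[y _ yS].
have /connectP[p ep Dy] := e_conn x y.
elim: p x xS ep Dy => [|z p IHp] x xS /=; first by move=> _ Dy; rewrite Dy xS in yS.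
case/andP=> exz ep Dy; have [zS|zS] := boolP (z \in S); first exact: IHp zS ep Dy.
by exists x, z.
Qed.

(** Induction on the number of vertices outside [S]: an edge leaving [S] provides the next vertex.
    That [S] is connected and contains every cycle is the invariant that lets [dist_attach]
    apply. *)
Lemma distmx_negative_type (R : realType) (n : nat) (e : rel 'I_n)
    (w : {set 'I_n} -> R) (S : {set 'I_n}) :
  symmetric e -> connected_graph e -> (forall i j, e i j -> 0 < w [set i; j]) ->
  (forall c, ucycle e c -> (2 < size c)%N -> {subset c <= S}) ->
  connected_in e S -> S != set0 ->
  negative_type_on (distmx e w) S -> negative_type_on (distmx e w) setT.
Proof.
move=> e_sym e_conn w_gt0.
have [k] := ubnP #|~: S|; elim: k S => // k IHk S leS cycS conS S0 negS.
have [<-//|ST] := eqVneq S setT.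
have /set0Pn[x xS] := S0.
have [u [v [uS vS euv]]] := connected_exit e_conn xS ST.
apply: (IHk (v |: S)).
- apply: leq_trans (proper_card _) leS; rewrite properC.
  by apply/properP; split; [exact: subsetUr | exists v; rewrite ?setU11].
- by move=> c uc sz_c y /(cycS c uc sz_c) yS; rewrite inE yS orbT.
- exact: connected_inU1 euv.
- by apply/set0Pn; exists v; rewrite setU11.
apply: (@negative_type_pendant _ _ _ _ u v (w [set u; v])) => //; last 2 first.
- exact: w_gt0.
- by move=> y yS; rewrite !mxE; apply: dist_attach cycS conS uS vS euv yS.
- by apply/matrixP => i j; rewrite !mxE dist_sym.
- by move=> i; rewrite mxE distxx.
Qed.

Theorem theorem2p8 (R : realType) (n : nat) (e : rel 'I_n)
    (w : {set 'I_n} -> R)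
    (e_sym : symmetric e) (e_irr : irreflexive e)
    (w_gt0 : forall i j : 'I_n, e i j -> 0 < w [set i; j])
    (e_unicyclic : unicyclic e)
    (e_cycle3 : forall C : {set {set 'I_n}}, is_graph_cycle e C -> #|C| = 3%N) :
  strongly_unipositive (distmx e w).
Proof.
have [e_conn [C [cycC C_uniq]]] := e_unicyclic.
have [c [uc sz_c DC]] := cycC.
have Uc := ucycle_uniq uc.
have sz3 : size c = 3%N by rewrite -card_cycle_edges // -DC e_cycle3.
have D_sym : (distmx e w)^T = distmx e w by apply/matrixP => i j; rewrite !mxE dist_sym.
have D0 i : distmx e w i i = 0 by rewrite mxE distxx.
(* Any cycle has the same edge set as [c], hence its vertices lie on [c]. *)
have cycS c' : ucycle e c' -> (2 < size c')%N -> {subset c' <= [set x in c]}.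
  move=> uc' sz_c' x xc'; rewrite inE; apply: (cycle_edges_mem _ xc').
  by rewrite -DC; apply/esym/C_uniq; exists c'.
have n_gt2 : (2 < n)%N by rewrite -(card_ord n) -sz3 uniq_size_card.
have negD : negative_type_on (distmx e w) setT.
  apply: (distmx_negative_type e_sym e_conn w_gt0 cycS).
  (* The three vertices of the cycle are pairwise adjacent. *)
  - case: c uc sz3 {Uc sz_c DC cycS} => [|a [|b [|d []]]] // /andP[/= /and4P[eab ebd eda _] _] _.
    have [eba edb ead] : [/\ e b a, e d b & e a d] by rewrite e_sym eab e_sym ebd e_sym eda.
    move=> x y; rewrite !inE => /or3P[]/eqP-> /or3P[]/eqP->; rewrite ?connect0 //;
      by rewrite connect1 // /induced /= !inE !eqxx ?orbT.
  - by case: (c) sz3 => // a s _; apply/set0Pn; exists a; rewrite inE mem_head.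
  - case: c Uc sz3 {uc sz_c DC cycS} => [|a [|b [|d []]]] // Uc _.
    have [ab bd da] : [/\ a != b, b != d & d != a].
      by move: Uc; rewrite /= !inE negb_or (eq_sym d) => /and3P[/andP[-> ->] -> _].
    have sym := dist_sym e_sym e_conn w_gt0.
    apply: negative_type_triangle; rewrite // !mxE ?dist_gt0 //.
    + by rewrite addrC (sym b d) (sym d a) dist_triangle.
    + by rewrite addrC (sym d a) (sym a b) dist_triangle.
    + by rewrite addrC (sym a b) (sym b d) dist_triangle.
apply: strongly_unipositive_of_negative_type => //; first exact: ltnW.
  by rewrite /mxtrace big1.
by move=> v v_sum v0; apply: negD => // i; rewrite inE.
Qed.
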